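(* Let $\Delta t>0$ (independent of $n$) and let $\Omega\subset\mathbb{R}^3$ be a box with periodic boundary conditions in $\boldsymbol{x}$. Let $(f^n,\boldsymbol{E}^n,\boldsymbol{B}^n,\boldsymbol{B}^{n+1/2})_{n\ge 0}$, together with the intermediate states $f^{n+1,*}$, be produced by Scheme-II (the time-discrete scheme for the Vlasov-Maxwell system described in the context), and let $\rho^n,\boldsymbol{u}^n,\mathcal{T}^n$ be the density, macroscopic velocity and temperature of $f^n$. Then Scheme-II preserves the discrete total energy: for every $n\ge 0$, $$\mathcal{E}_{\rm total}^{n}=\mathcal{E}_{\rm total}^{n+1},$$ where $$\mathcal{E}_{\rm total}^n=\frac12\int_\Omega \rho^n\left(|\boldsymbol{u}^n|^2+3\mathcal{T}^n\right)\,d\boldsymbol{x}+\frac12\int_\Omega\left(|\boldsymbol{E}^n|^2+\boldsymbol{B}^{n+1/2}\cdot\boldsymbol{B}^{n-1/2}\right)d\boldsymbol{x}.$$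
   Context: **Vlasov-Maxwell system.** The continuous system is $\partial_t f+\boldsymbol{v}\cdot\nabla_{\boldsymbol{x}}f+(\boldsymbol{E}+\boldsymbol{v}\times\boldsymbol{B})\cdot\nabla_{\boldsymbol{v}}f=0$, $\partial_t\boldsymbol{E}-\nabla_{\boldsymbol{x}}\times\boldsymbol{B}=-\boldsymbol{J}$, $\partial_t\boldsymbol{B}+\nabla_{\boldsymbol{x}}\times\boldsymbol{E}=0$, with $\boldsymbol{J}=\int_{\mathbb{R}^3}\boldsymbol{v}f\,d\boldsymbol{v}$, $\boldsymbol{x}\in\Omega$, $\boldsymbol{v}\in\mathbb{R}^3$. **Macroscopic quantities.** For a distribution function $f(\boldsymbol{x},\boldsymbol{v})$, the density $\rho$ (assumed positive), velocity $\boldsymbol{u}$ and temperature $\mathcal{T}$ (assumed positive) are defined by $\rho=\int_{\mathbb{R}^3}f\,d\boldsymbol{v}$, $\rho\boldsymbol{u}=\int_{\mathbb{R}^3}\boldsymbol{v}f\,d\boldsymbol{v}$, $\frac12\rho|\boldsymbol{u}|^2+\frac32\rho\mathcal{T}=\frac12\int_{\mathbb{R}^3}|\boldsymbol{v}|^2f\,d\boldsymbol{v}$. All functions are taken smooth and periodic in $\boldsymbol{x}$, and sufficiently decaying in $\boldsymbol{v}$ for all integrals to make sense. **Hermite expansion.** For $\alpha\in\mathbb{N}^3$ (with $0\in\mathbb{N}$), $|\alpha|=\alpha_1+\alpha_2+\alpha_3$, let $$\mathcal{H}_{\mathcal{T},\alpha}(\boldsymbol{\xi})=\frac{1}{(2\pi)^{3/2}}\mathcal{T}^{-\frac{|\alpha|+3}{2}}\prod_{d=1}^3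 H_{\alpha_d}(\xi_d)\exp(-\xi_d^2/2),\qquad H_k(x)=(-1)^ke^{x^2/2}\frac{d^k}{dx^k}e^{-x^2/2}.$$ A distribution function $f$ is expanded as $f=\sum_\alpha f_\alpha(\boldsymbol{x})\,\mathcal{H}_{\mathcal{T},\alpha}\big((\boldsymbol{v}-\boldsymbol{u})/\sqrt{\mathcal{T}}\big)$ with $\boldsymbol{u},\mathcal{T}$ its own velocity and temperature; consequently $f_0=\rho$, $f_{e_i}=0$ and $\sum_{d=1}^3f_{2e_d}=0$, where $e_i$ is the $i$-th unit multi-index. $f_\alpha$ is zero if a component of $\alpha$ is negative. The expansion is truncated at order $|\alpha|\le M$. $\epsilon_{dlm}$ is the Levi-Civita symbol. **Scheme-II.** Given $(f^n,\boldsymbol{E}^n,\boldsymbol{B}^n)$, the next state satisfies $$\frac{f^{n+1,*}-f^n}{\Delta t}=-\boldsymbol{v}\cdot\nabla_{\boldsymbol{x}}f^n,$$ $$\frac{\boldsymbol{B}^{n+1/2}-\boldsymbol{B}^n}{\Delta t/2}=-\nabla_{\boldsymbol{x}}\times\boldsymbol{E}^n,$$ $$\frac{\boldsymbol{E}^{n+1}-\boldsymbol{E}^n}{\Delta t}=\nabla_{\boldsymbol{x}}\times\boldsymbol{B}^{n+1/2}-\boldsymbol{J}^{n+1/2},$$ $$\frac{\boldsymbol{B}^{n+1}-\boldsymbol{B}^{n+1/2}}{\Delta t/2}=-\nabla_{\boldsymbol{x}}\times\boldsymbol{E}^{n+1},$$ $$\frac{\boldsymbol{u}^{n+1}-\boldsymbol{u}^{n+1,*}}{\Delta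 t}=\frac{\boldsymbol{E}^n+\boldsymbol{E}^{n+1}}{2}+\frac{\boldsymbol{u}^{n+1,*}+\boldsymbol{u}^{n+1}}{2}\times\boldsymbol{B}^{n+1/2},$$ $$\frac{f_\alpha^{n+1}-f_\alpha^{n+1,*}}{\Delta t}=\sum_{d,l,m=1}^3\epsilon_{dlm}(\alpha_l+1)B_m^{n+1/2}f^{n+1,*}_{\alpha-e_d+e_l},\qquad 2\le|\alpha|\le M.$$ Here $\rho^{n+1,*},\boldsymbol{u}^{n+1,*},\mathcal{T}^{n+1,*}$ are the density, velocity and temperature of $f^{n+1,*}$, and $f_\alpha^{n+1,*}$ its Hermite coefficients with respect to $\boldsymbol{u}^{n+1,*},\mathcal{T}^{n+1,*}$. The density and temperature are unchanged in the Lorentz step: $\rho^{n+1}=\rho^{n+1,*}$, $\mathcal{T}^{n+1}=\mathcal{T}^{n+1,*}$. The current is $$\boldsymbol{J}^{n+1/2}=\int_{\mathbb{R}^3}\boldsymbol{v}\,\frac{f^{n+1,*}+f^{n+1}}{2}\,d\boldsymbol{v}=\frac{\rho^{n+1,*}(\boldsymbol{u}^{n+1}+\boldsymbol{u}^{n+1,*})}{2}.$$ The new function $f^{n+1}$ is $\sum_{|\alpha|\le M}f_\alpha^{n+1}\mathcal{H}_{\mathcal{T}^{n+1},\alpha}\big((\boldsymbol{v}-\boldsymbol{u}^{n+1})/\sqrt{\mathcal{T}^{n+1}}\big)$, with $f_0^{n+1}=\rho^{n+1}$ and $f^{n+1}_{e_i}=0$; its density, velocity and temperature are $\rho^{n+1},\boldsymbol{u}^{n+1},\mathcal{T}^{n+1}$.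 **Initial half step.** For $n=0$, $\boldsymbol{B}^{-1/2}$ is defined by the same relation as at later levels, $\frac{\boldsymbol{B}^{0}-\boldsymbol{B}^{-1/2}}{\Delta t/2}=-\nabla_{\boldsymbol{x}}\times\boldsymbol{E}^{0}$. *)

(* Defs.v *)
From HB Require Import structures.
From mathcomp Require Import all_boot all_order all_algebra.
From mathcomp Require Import all_classical all_reals all_analysis.
Set Implicit Arguments.
Unset Strict Implicit.
Unset Printing Implicit Defensive.
Import Order.TTheory GRing.Theory Num.Theory.
Import numFieldNormedType.Exports.
Local Open Scope classical_set_scope.
Local Open Scope ring_scope.

Section VectorCalculus.
Context {R : realType}.

Definition dot (u v : 'rV[R]_3) : R := \sum_(i < 3) u 0 i * v 0 i.

(* Addition on 'I_3 is modulo 3: the even permutations (d, l, m) of the three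
   indices are exactly the cyclic ones (d, d + 1, d + 2). *)
Definition levi_civita (d l m : 'I_3) : R :=
  if (l == d + 1) && (m == d + 2%:R) then 1
  else if (l == d + 2%:R) && (m == d + 1) then -1
  else 0.

Definition cross (u v : 'rV[R]_3) : 'rV[R]_3 :=
  \row_d \sum_(l < 3) \sum_(m < 3) levi_civita d l m * u 0 l * v 0 m.

Definition basis (d : 'I_3) : 'rV[R]_3 := delta_mx 0 d.

Definition partial (d : 'I_3) (g : 'rV[R]_3 -> R) (x : 'rV[R]_3) : R :=
  'D_(basis d) g x.

Definition curl (F : 'rV[R]_3 -> 'rV[R]_3) (x : 'rV[R]_3) : 'rV[R]_3 :=
  \row_d \sum_(l < 3) \sum_(m < 3)
    levi_civita d l m * partial l (fun y => F y 0 m) x.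

Fixpoint iter_derive (V : normedModType R) (ws : seq V) (g : V -> R) : V -> R :=
  if ws is w :: ws' then (fun x => 'D_w (iter_derive ws' g) x) else g.

(* C^oo: all iterated directional derivatives exist and are continuous. *)
Definition smooth (V : normedModType R) (g : V -> R) : Prop :=
  forall ws : seq V, continuous (iter_derive ws g) /\
    forall x w, derivable (iter_derive ws g) x w.

(* Periodicity for the box with opposite corners a and b. *)
Definition periodic (T : Type) (a b : 'rV[R]_3) (g : 'rV[R]_3 -> T) : Prop :=
  forall (d : 'I_3) (x : 'rV[R]_3), g (x + (b 0 d - a 0 d) *: basis d) = g x.

Definition vec3 (p : R * R * R) : 'rV[R]_3 :=
  \row_(i < 3) [:: p.1.1; p.1.2; p.2]`_i.

(* Integration over D with respect to the Lebesgue measure of R^3. *)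
Definition int3 (D : set 'rV[R]_3) (g : 'rV[R]_3 -> R) : R :=
  Rintegral ((lebesgue_measure \x lebesgue_measure) \x lebesgue_measure)%E
    (vec3 @^-1` D) (g \o vec3).

Definition box (a b : 'rV[R]_3) : set 'rV[R]_3 :=
  [set x | forall i, a 0 i <= x 0 i <= b 0 i].

Definition smooth_periodic_field (a b : 'rV[R]_3)
    (F : 'rV[R]_3 -> 'rV[R]_3) : Prop :=
  (forall i, smooth (fun x => F x 0 i)) /\ periodic a b F.

End VectorCalculus.

Section Distributions.
Context {R : realType}.
Implicit Types (f : 'rV[R]_3 -> 'rV[R]_3 -> R) (x v : 'rV[R]_3).

Definition density f x : R := int3 setT (f x).

Definition momentum f x : 'rV[R]_3 :=
  \row_i int3 setT (fun v => v 0 i * f x v).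

Definition velocity f x : 'rV[R]_3 := (density f x)^-1 *: momentum f x.

(* Solution T of  rho |u|^2 / 2 + 3 rho T / 2 = (\int |v|^2 f dv) / 2. *)
Definition temperature f x : R :=
  (int3 setT (fun v => dot v v * f x v)
     - density f x * dot (velocity f x) (velocity f x)) / (3 * density f x).

(* Smooth in (x, v), periodic in x, and rapidly decreasing in v together with
   all x-derivatives, so that all moments and Hermite coefficients of f and of
   v . grad_x f are given by convergent integrals; the density and temperature
   are positive. *)
Record admissible (a b : 'rV[R]_3) f : Prop := {
  adm_smooth : smooth (fun p : 'rV[R]_3 * 'rV[R]_3 => f p.1 p.2);
  adm_periodic : periodic a b f;
  adm_decay : forall (ws : seq 'rV[R]_3) (k : nat), exists C : R, forall x v,
    `|v| ^+ k * `|iter_derive ws (fun y => f y v) x| <= C;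
  adm_density : forall x, 0 < density f x;
  adm_temperature : forall x, 0 < temperature f x }.

Definition hermite_poly (k : nat) (y : R) : R :=
  (-1) ^+ k * expR (y ^+ 2 / 2) *
  derive1n k (fun z : R => expR (- (z ^+ 2 / 2))) y.

Definition mdeg (alpha : {ffun 'I_3 -> nat}) : nat := (\sum_(d < 3) alpha d)%N.

Definition hermite_fun (T : R) (alpha : {ffun 'I_3 -> nat}) (xi : 'rV[R]_3) : R :=
  ((2 * pi) `^ (3 / 2))^-1 * T `^ (- ((mdeg alpha + 3)%:R / 2)) *
  \prod_(d < 3) (hermite_poly (alpha d) (xi 0 d) * expR (- (xi 0 d ^+ 2 / 2))).

Definition scaled_velocity f x v : 'rV[R]_3 :=
  (Num.sqrt (temperature f x))^-1 *: (v - velocity f x).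

(* The coefficient f_alpha of the expansion
     f(x, v) = \sum_alpha f_alpha(x) hermite_fun T alpha ((v - u) / sqrt T),
   with u, T the velocity and temperature of f, extracted by the orthogonality
     \int H_j(y) H_k(y) exp(- y^2 / 2) dy = sqrt (2 pi) k! [j = k]. *)
Definition hermite_coef f (alpha : {ffun 'I_3 -> nat}) x : R :=
  temperature f x `^ ((mdeg alpha)%:R / 2) / (\prod_(d < 3) (alpha d)`!)%N%:R *
  int3 setT (fun v =>
    f x v * \prod_(d < 3) hermite_poly (alpha d) (scaled_velocity f x v 0 d)).

Definition munit (d : 'I_3) : {ffun 'I_3 -> nat} := [ffun i => (i == d : nat)].

(* f_(alpha - e_d + e_l), which is 0 if alpha - e_d + e_l has a negative
   component, i.e. if d != l and alpha_d = 0. *)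
Definition hermite_coef_shift f (alpha : {ffun 'I_3 -> nat}) (d l : 'I_3) x : R :=
  if (d != l) && (alpha d == 0%N) then 0
  else hermite_coef f [ffun i => (alpha i + (i == l) - (i == d))%N] x.

(* Multi-indices with |alpha| <= M have all components in 'I_M.+1. *)
Definition hermite_truncation (M : nat) f x v : R :=
  \sum_(beta : {ffun 'I_3 -> 'I_M.+1} | (mdeg [ffun d => (beta d : nat)] <= M)%N)
    hermite_coef f [ffun d => (beta d : nat)] x *
    hermite_fun (temperature f x) [ffun d => (beta d : nat)]
      (scaled_velocity f x v).

End Distributions.

Section SchemeII.
Context {R : realType}.
Implicit Types (f fs : 'rV[R]_3 -> 'rV[R]_3 -> R)
  (E B Bh Bm Bp : 'rV[R]_3 -> 'rV[R]_3).

(* J^(n+1/2), for fs = f^{n+1,*} and f1 = f^(n+1). *)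
Definition current fs f1 (x : 'rV[R]_3) : 'rV[R]_3 :=
  \row_i int3 setT (fun v => v 0 i * ((fs x v + f1 x v) / 2)).

(* One step from (f0, E0, B0) = (f, E, B)^n to (f1, E1, B1) = (f, E, B)^(n+1),
   with intermediate states fs = f^{n+1,*} and Bh = B^(n+1/2).  The quantities
   u^(n+1), T^(n+1), f_alpha^(n+1) are the velocity, temperature and Hermite
   coefficients of f1, and similarly for fs. *)
Record schemeII_step (M : nat) (dt : R) f0 fs f1 E0 E1 B0 Bh B1 : Prop := {
  step_transport : forall x v,
    (fs x v - f0 x v) / dt
    = - \sum_(d < 3) v 0 d * partial d (fun y => f0 y v) x;
  step_faraday_half : forall x,
    (dt / 2)^-1 *: (Bh x - B0 x) = - curl E0 x;
  step_ampere : forall x,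
    dt^-1 *: (E1 x - E0 x) = curl Bh x - current fs f1 x;
  step_faraday : forall x,
    (dt / 2)^-1 *: (B1 x - Bh x) = - curl E1 x;
  step_velocity : forall x,
    dt^-1 *: (velocity f1 x - velocity fs x)
    = 2^-1 *: (E0 x + E1 x)
      + cross (2^-1 *: (velocity fs x + velocity f1 x)) (Bh x);
  step_coef : forall alpha : {ffun 'I_3 -> nat}, (2 <= mdeg alpha <= M)%N ->
    forall x,
    (hermite_coef f1 alpha x - hermite_coef fs alpha x) / dt
    = \sum_(d < 3) \sum_(l < 3) \sum_(m < 3)
        levi_civita d l m * (alpha l).+1%:R * Bh x 0 m
          * hermite_coef_shift fs alpha d l x;
  step_density : forall x, density f1 x = density fs x;
  step_temperature : forall x, temperature f1 x = temperature fs x;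
  step_expansion : forall x v, f1 x v = hermite_truncation M f1 x v;
  step_coef0 : forall x, hermite_coef f1 [ffun=> 0%N] x = density f1 x;
  step_coef1 : forall (i : 'I_3) x, hermite_coef f1 (munit i) x = 0 }.

(* A run of the scheme.  The magnetic field at half-integer times is indexed
   with a shift: Bh n is B^(n-1/2), so that Bh 0 is B^(-1/2) and B^(n+1/2) is
   Bh n.+1.  Moreover fs n is f^{n+1,*}. *)
Record schemeII (M : nat) (dt : R) (a b : 'rV[R]_3)
    (f fs : nat -> 'rV[R]_3 -> 'rV[R]_3 -> R)
    (E B Bh : nat -> 'rV[R]_3 -> 'rV[R]_3) : Prop := {
  run_f : forall n, admissible a b (f n);
  run_fs : forall n, admissible a b (fs n);
  run_E : forall n, smooth_periodic_field a b (E n);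
  run_B : forall n, smooth_periodic_field a b (B n);
  run_Bh : forall n, smooth_periodic_field a b (Bh n);
  run_init : forall x,
    (dt / 2)^-1 *: (B 0%N x - Bh 0%N x) = - curl (E 0%N) x;
  run_step : forall n,
    schemeII_step M dt (f n) (fs n) (f n.+1) (E n) (E n.+1)
      (B n) (Bh n.+1) (B n.+1) }.

(* For the n-th total energy, Bm = B^(n-1/2) and Bp = B^(n+1/2). *)
Definition total_energy (a b : 'rV[R]_3) f E Bm Bp : R :=
  2^-1 * int3 (box a b) (fun x =>
    density f x * (dot (velocity f x) (velocity f x) + 3 * temperature f x))
  + 2^-1 * int3 (box a b) (fun x => dot (E x) (E x) + dot (Bp x) (Bm x)).

End SchemeII.

(* Main.v *)
Require Import Defs.
From HB Require Import structures.
From mathcomp Require Import all_boot all_order all_algebra.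
From mathcomp Require Import all_classical all_reals all_analysis.
From mathcomp Require Import measurable_realfun.
From mathcomp Require Import ring lra.
Set Implicit Arguments.
Unset Strict Implicit.
Unset Printing Implicit Defensive.
Import Order.TTheory GRing.Theory Num.Theory.
Import numFieldNormedType.Exports.
(* Restores [Defs.basis] and [Defs.periodic], shadowed by the libraries. *)
Import Defs.
Local Open Scope classical_set_scope.
Local Open Scope ring_scope.

(* The energy rho (|u|^2 + 3 T) of a distribution f is the second moment
   \int |v|^2 f dv.  In the transport step this moment changes by the divergence
   of - dt \int |v|^2 v f dv; exchanging the x- and v-integrals, its integral over
   the box vanishes because that of every partial_d f(., v) does, f being periodic.
   In the Lorentz step the magnetic force is orthogonal to u^(n+1) + u^{n+1,*}, so
   the fluid gains exactly dt J . (E^n + E^(n+1)).  Combining the two half steps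
   for B at consecutive levels gives B^(n+1/2) - B^(n-1/2) = - dt curl E^n, also
   for n = 0 by the definition of B^(-1/2), and with Ampere's law the change of
   |E|^2 + B^(n+1/2) . B^(n-1/2) is - dt J . (E^n + E^(n+1)) plus dt times the
   divergence of B^(n+1/2) \times (E^n + E^(n+1)), which integrates to 0. *)

(** * Measurability of continuous functions *)

Section MeasurabilityOfContinuous.
Context {R : realType}.

Definition countable_basis (T : topologicalType) (B : set (set T)) :=
  countable B /\ topology_structure.basis B.

Definition prod_cover (S T : Type) (A : set (set S)) (B : set (set T)) :
  set (set (S * T)) := [set U `*` V | U in A & V in B].

Lemma countable_basis_prod (S T : topologicalType) (A : set (set S))
    (B : set (set T)) :
  countable_basis A -> countable_basis B -> countable_basis (prod_cover A B).
Proof.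
move=> [cA [oA bA]] [cB [oB bB]]; split; last split.
- have -> : prod_cover A B = (fun p : set S * set T => p.1 `*` p.2) @` (A `*` B).
    apply/seteqP; split=> [_ [U AU [V BV <-]]|_ [[U V] [/= AU BV] <-]].
      by exists (U, V).
    by exists U => //; exists V.
  apply: (sub_countable (card_image_le _ _)). exact: countableX.
- move=> _ [U AU [V BV <-]]; rewrite openE => -[x y] [/= Ux Vy].
  by exists (U, V) => //=; split; apply: open_nbhs_nbhs; split=> //;
    [exact: oA|exact: oB].
- move=> [x y] W [[U V] /= [Ux Vy] UVW].
  have [U' [/= AU' U'x] U'U] := bA x _ Ux.
  have [V' [/= BV' V'y] V'V] := bB y _ Vy.
  exists (U' `*` V') => /=; first by split=> //; exists U' => //; exists V'.
  by move=> [s t] [/= /U'U Us /V'V Vt]; exact: UVW.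
Qed.

Lemma countable_basis_open (T : topologicalType) (B : set (set T)) (U : set T) :
  countable_basis B -> open U ->
  U = \bigcup_(V in [set V | B V /\ V `<=` U]) V.
Proof.
move=> [_ [_ bB]] oU; apply/seteqP; split=> [x Ux|x [V [_ VU] Vx]]; last exact: VU.
have [V [BV Vx] VU] : filter_from [set V | B V /\ V x] id U.
  by apply: bB; exact: open_nbhs_nbhs.
by exists V.
Qed.

Lemma countable_bigcup_measurable d (T : measurableType d) (F : set (set T)) :
  countable F -> F `<=` measurable -> measurable (\bigcup_(V in F) V).
Proof.
have [->|F0] := eqVneq F set0; first by rewrite bigcup_set0.
have /set0P[V0 FV0] := F0.
move=> cF mF; have /pfcard_geP[F00|[f]] := cF.
  by rewrite F00 bigcup_set0.
have -> : \bigcup_(V in F) V = \bigcup_n f n.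
  apply/seteqP; split=> [x [V FV Vx]|x [n _ fx]]; last first.
    by exists (f n) => //; exact: funS.
  have [n _ fnV] := @surj _ _ _ _ f V FV.
  by exists n => //; rewrite fnV.
by apply: bigcup_measurable => n _; apply: mF; exact: funS.
Qed.

Definition rat_itvs : set (set R) :=
  (fun p : rat * rat => `]ratr p.1, ratr p.2[%classic) @` setT.

Lemma rat_itvs_basis : countable_basis rat_itvs.
Proof.
split; last split.
- by apply: (sub_countable (card_image_le _ _)); exact: countableP.
- by move=> _ [p _ <-]; exact: interval_open.
- move=> x U /nbhs_ballP[e /= e0 xeU].
  have /rat_in_itvoo[p /itvP px] : x - e < x by rewrite ltrBlDr ltrDl.
  have /rat_in_itvoo[q /itvP qx] : x < x + e by rewrite ltrDl.
  exists `]ratr p, ratr q[%classic => /=.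
    by split; [exists (p, q)|rewrite in_itv/= px qx].
  move=> y /=; rewrite in_itv/= => /andP[py yq]; apply: xeU.
  by rewrite /ball/= ltr_distlC (lt_trans _ py) ?px//= (lt_trans yq)// qx.
Qed.

Lemma rat_itvs_measurable : rat_itvs `<=` measurable.
Proof. by move=> _ [p _ <-]; exact: measurable_itv. Qed.

Lemma prod_cover_measurable d1 d2 (S : measurableType d1) (T : measurableType d2)
    (A : set (set S)) (B : set (set T)) :
  A `<=` measurable -> B `<=` measurable -> prod_cover A B `<=` measurable.
Proof.
by move=> mA mB _ [U AU [V BV <-]]; apply: measurableX; [exact: mA|exact: mB].
Qed.

Definition rat_boxes : set (set (R * R * R)) :=
  prod_cover (prod_cover rat_itvs rat_itvs) rat_itvs.

Lemma rat_boxes_basis : countable_basis rat_boxes.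
Proof. by do 2 ?apply: countable_basis_prod; exact: rat_itvs_basis. Qed.

Lemma rat_boxes_measurable : rat_boxes `<=` measurable.
Proof. by do 2 ?apply: prod_cover_measurable; exact: rat_itvs_measurable. Qed.

(** The measurable sets of [R * R * R] are those of the product sigma-algebra, so openness has to be
    turned into a countable union of measurable rectangles. Boxes with rational endpoints form a
    countable basis and provide it. *)
Lemma open_measurable_R3 (U : set (R * R * R)) : open U -> measurable U.
Proof.
move=> oU; rewrite (countable_basis_open rat_boxes_basis oU).
apply: countable_bigcup_measurable.
  by apply: sub_countable rat_boxes_basis.1; apply: subset_card_le => V [].
by move=> V [/rat_boxes_measurable].
Qed.

Lemma open_measurable_R3R3 (U : set ((R * R * R) * (R * R * R))) :
  open U -> measurable U.
Proof.
have bB := countable_basis_prod rat_boxes_basis rat_boxes_basis.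
move=> oU; rewrite (countable_basis_open bB oU).
apply: countable_bigcup_measurable.
  by apply: sub_countable bB.1; apply: subset_card_le => V [].
move=> V [+ _]; apply: prod_cover_measurable; exact: rat_boxes_measurable.
Qed.

Lemma continuous_measurable_R3 (g : R * R * R -> R) :
  continuous g -> measurable_fun setT g.
Proof.
move=> /continuousP cg; apply: (measurability _ (RGenOpens.measurableE R)).
move=> _ [_ [a [b ->] <-]]; rewrite setTI.
by apply: open_measurable_R3; exact/cg/interval_open.
Qed.

Lemma continuous_measurable_R3R3 (g : (R * R * R) * (R * R * R) -> R) :
  continuous g -> measurable_fun setT g.
Proof.
move=> /continuousP cg; apply: (measurability _ (RGenOpens.measurableE R)).
move=> _ [_ [a [b ->] <-]]; rewrite setTI.
by apply: open_measurable_R3R3; exact/cg/interval_open.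
Qed.

End MeasurabilityOfContinuous.

Lemma I3P (d : 'I_3) : [\/ d = 0, d = 1 | d = 2%:R].
Proof.
by case: d => [[|[|[|//]]] ?]; [constructor 1|constructor 2|constructor 3]; exact: val_inj.
Qed.

Lemma I3E : (((0 + 1)%R = 1%R :> 'I_3) * ((0 + 2)%R = 2%R :> 'I_3) *
  ((1 + 1)%R = 2%R :> 'I_3) * ((1 + 2)%R = 0%R :> 'I_3) *
  ((2 + 1)%R = 0%R :> 'I_3) * ((2 + 2)%R = 1%R :> 'I_3))%type.
Proof. by do ![split]; exact: val_inj. Qed.

(** * Integrability over the box and of moments *)

Section ProductMeasure.
Context d1 d2 (S : measurableType d1) (T : measurableType d2) (R : realType).
Variables (m1 : {sigma_finite_measure set S -> \bar R})
  (m2 : {sigma_finite_measure set T -> \bar R}).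

Lemma sigma_finite_prod : sigma_finite setT (m1 \x m2)%E.
Proof.
by case: (lebesgue_integral_fubini.measure_function_Measure_isSigmaFinite__to__measure_function_isSigmaFinite
  m1 m2).
Qed.

(* The canonical sigma-finite structure on [m1 \x m2] found by unification is
   the one for subprobabilities, which does not apply to Lebesgue measures. *)
Definition prod_measure : {sigma_finite_measure set (S * T)%type -> \bar R} :=
  HB.pack (m1 \x m2)%E
    (Measure_isSigmaFinite.Build _ _ _ (m1 \x m2)%E sigma_finite_prod).

(** By Tonelli, the iterated integral of [|g x * h y|] is the product of the two L^1 norms, both
    finite. *)
Lemma integrable_prodM (g : S -> R) (h : T -> R) :
  m1.-integrable setT (EFin \o g) -> m2.-integrable setT (EFin \o h) ->
  prod_measure.-integrable setT (EFin \o fun p => g p.1 * h p.2).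
Proof.
move=> ig ih.
have mg : measurable_fun setT g by apply/measurable_EFinP; exact: measurable_int ig.
have mh : measurable_fun setT h by apply/measurable_EFinP; exact: measurable_int ih.
have mgh : measurable_fun setT (fun p : S * T => g p.1 * h p.2).
  by apply: measurable_funM; apply: measurableT_comp.
apply/integrable12ltyP; first exact/measurable_EFinP.
have -> : (fun x => \int[m2]_y `|(EFin \o (fun p => (g p.1 * h p.2)%R)) (x, y)|)%E =
    (fun x => \int[m2]_y `|(h y)%:E| * `|(g x)%:E|)%E.
  apply/funext => x; rewrite muleC -ge0_integralZl//.
    by apply: eq_integral => y _ /=; rewrite normrM EFinM.
  by apply: measurableT_comp => //; exact/measurable_EFinP.
have [_ goo] := integrableP _ _ _ ig.
have [_ hoo] := integrableP _ _ _ ih.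
rewrite ge0_integralZl//; last 2 first.
- by apply: measurableT_comp => //; exact/measurable_EFinP.
- exact: integral_ge0.
by rewrite lte_mul_pinfty// ?integral_ge0// ge0_fin_numE// integral_ge0.
Qed.

End ProductMeasure.

Section Integrability.
Context {R : realType}.
Local Notation leb := (@lebesgue_measure R).

(** A neighbourhood in the matrix topology contains a product of neighbourhoods of the entries, so
    continuity is checked entry by entry, and each entry is a projection. *)
Lemma continuous_vec3 : continuous (@vec3 R).
Proof.
move=> p A [P Pn PA].
have : nbhs p [set q | forall j : 'I_3, P 0 j (vec3 q 0 j)].
  apply: (@filter_forall _ _ (fun j q => P 0 j (vec3 q 0 j)) _ (nbhs_filter p)) => j.
  have : continuous (fun q : R * R * R => vec3 q 0 j).
    rewrite (_ : (fun _ => _) = fun q : R * R * R => [:: q.1.1; q.1.2; q.2]`_j);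
      last by apply/funext => q; rewrite mxE.
    case: j => [[|[|[|//]]] ?] q /=.
    - by apply: (@cvg_comp _ _ _ fst fst); exact: cvg_fst.
    - by apply: (@cvg_comp _ _ _ fst snd); [exact: cvg_fst|exact: cvg_snd].
    - exact: cvg_snd.
  by move=> /(_ p); apply; exact: Pn.
by apply: filterS => q Pq; apply: PA => i j; rewrite ord1.
Qed.

Lemma vec3E (p : R * R * R) :
  (vec3 p 0 0 = p.1.1) * (vec3 p 0 1 = p.1.2) * (vec3 p 0 2%:R = p.2).
Proof. by rewrite !mxE. Qed.

Lemma normr_coord_le n (v : 'rV[R]_n) i : `|v 0 i| <= `|v|.
Proof. by rewrite [leRHS]/Num.norm /= mx_normrE; exact: (le_bigmax _ _ (0, i)). Qed.

(** The measure behind [int3], equipped with a sigma-finite structure so that products such as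
    [prod_measure mu3 mu3] can be formed and Fubini applied to them. *)
Definition mu3 := prod_measure (prod_measure leb leb) leb.

(** By evenness the integral is twice the arctangent integral over the half-line. *)
Lemma integrable_oneDsqrV : leb.-integrable setT (EFin \o (fun x => (oneDsqr x)^-1)).
Proof.
apply/integrableP; split.
  apply/measurable_EFinP; apply: continuous_measurable_fun.
  exact: continuous_oneDsqrV.
rewrite (_ : (\int[leb]_x _)%E = (\int[leb]_x ((oneDsqr x)^-1)%:E)%E); last first.
  by apply: eq_integral => x _ /=; rewrite ger0_norm// invr_ge0.
rewrite ge0_symfun_integralT//=.
- rewrite (_ : [set x | _] = `[0, +oo[%classic); last first.
    by apply/seteqP; split => x/=; rewrite in_itv/= andbT.
  by rewrite integral0y_oneDsqr -EFinM ltry.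
- exact: continuous_oneDsqrV.
- by move=> x; rewrite /= /oneDsqr sqrrN.
Qed.

(** A common integrable majorant, up to a constant, for functions of [v] that decay faster than
    every power. Being a product over the coordinates, it inherits integrability from its
    one-dimensional factors. *)
Definition weight (p : R * R * R) : R :=
  (oneDsqr p.1.1)^-1 * (oneDsqr p.1.2)^-1 * (oneDsqr p.2)^-1.

Lemma integrable_weight : mu3.-integrable setT (EFin \o weight).
Proof.
have H := integrable_oneDsqrV.
exact: (integrable_prodM (integrable_prodM H H) H).
Qed.

Lemma weight_gt0 p : 0 < weight p.
Proof. by rewrite /weight !mulr_gt0// invr_gt0 oneDsqr_gt0. Qed.

Lemma weightV_le p : (weight p)^-1 <= (1 + `|vec3 p| ^+ 2) ^+ 3.
Proof.
have H (i : 'I_3) : oneDsqr (vec3 p 0 i) <= 1 + `|vec3 p| ^+ 2.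
  rewrite /oneDsqr lerD2l -(ger0_norm (sqr_ge0 (vec3 p 0 i))) normrX.
  by rewrite lerXn2r ?nnegrE// normr_coord_le.
move: (H 0) (H 1) (H 2%:R); rewrite !vec3E => H0 H1 H2.
rewrite /weight !invfM !invrK exprS expr2 mulrA.
by rewrite !ler_pM// ?mulr_ge0// ltW// oneDsqr_gt0.
Qed.

(** Dividing by [weight] costs at most a factor [(1 + |v|^2)^3], whose expansion calls for the decay
    bounds of orders [k], [k + 2], [k + 4] and [k + 6]. The constant is uniform in the parameter
    [x]. *)
Lemma decay_weight (X : Type) (h : X -> 'rV[R]_3 -> R) :
  (forall k : nat, exists C : R, forall x v, `|v| ^+ k * `|h x v| <= C) ->
  forall k : nat, exists2 C : R, 0 <= C & forall x p,
    `|vec3 p| ^+ k * `|h x (vec3 p)| <= C * weight p.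
Proof.
move=> dh k.
have [C0 H0] := dh k; have [C2 H2] := dh (k + 2)%N.
have [C4 H4] := dh (k + 4)%N; have [C6 H6] := dh (k + 6)%N.
pose C := C0 + 3 * C2 + 3 * C4 + C6.
exists `|C| => // x p.
rewrite -ler_pdivrMr ?weight_gt0//.
apply: (@le_trans _ _ (`|vec3 p| ^+ k * `|h x (vec3 p)| *
    (1 + `|vec3 p| ^+ 2) ^+ 3)).
  by rewrite ler_wpM2l ?weightV_le// mulr_ge0// exprn_ge0.
apply: le_trans (ler_norm _).
move: (H0 x (vec3 p)) (H2 x (vec3 p)) (H4 x (vec3 p)) (H6 x (vec3 p)).
rewrite !exprD /C.
set n := `|vec3 p|; set nk := n ^+ k; set z := `|h x _|.
have -> : nk * z * (1 + n ^+ 2) ^+ 3 = nk * z + 3 * (nk * n ^+ 2 * z)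
  + 3 * (nk * n ^+ 4 * z) + nk * n ^+ 6 * z by ring.
by move=> A0 A2 A4 A6; rewrite !lerD// ler_pM2l.
Qed.

End Integrability.

Lemma continuous_pair (S T U : topologicalType) (g : S -> T) (h : S -> U) x :
  {for x, continuous g} -> {for x, continuous h} ->
  {for x, continuous (fun s => (g s, h s))}.
Proof. by move=> cg ch; exact: (@cvg_pair _ _ _ _ _ _ _ _ _ g h cg ch). Qed.

Section Box.
Context {R : realType} (a b : 'rV[R]_3).
Local Notation leb := (@lebesgue_measure R).

Definition side (d : 'I_3) : set R := `[a 0 d, b 0 d].

(** The indicator of the box, factored over the coordinates so that it can be integrated one
    variable at a time. *)
Definition cutoff (p : R * R * R) : R :=
  \1_(side 0) p.1.1 * \1_(side 1) p.1.2 * \1_(side 2%:R) p.2.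

Lemma cutoffE p : cutoff p = \1_(vec3 @^-1` box a b) p.
Proof.
rewrite /cutoff !indicE -!natrM; congr (_%:R).
have E d t : (t \in side d) = (a 0 d <= t <= b 0 d).
  by apply/idP/idP; rewrite inE /side /= in_itv.
rewrite !mulnb !E -!vec3E; congr nat_of_bool; apply/idP/idP; rewrite inE.
- move=> /andP[/andP[H0 H1] H2] i.
  by have [->|->|->] := I3P i.
- by move=> H; rewrite !H.
Qed.

Lemma int3_box (g : 'rV[R]_3 -> R) :
  int3 (box a b) g = Rintegral mu3 setT (fun p => cutoff p * g (vec3 p)).
Proof.
rewrite /int3 (_ : Rintegral _ _ _ = Rintegral mu3 (vec3 @^-1` box a b) (g \o vec3))//.
rewrite Rintegral_mkcond; congr Rintegral; apply/funext => p.
by rewrite patch_indic /= cutoffE mulrC.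
Qed.

Lemma integrable_cutoff : mu3.-integrable setT (EFin \o cutoff).
Proof.
have H d : leb.-integrable setT (EFin \o \1_(side d)) by exact: integrable_indic_itv.
exact: (integrable_prodM (integrable_prodM (H 0) (H 1)) (H 2%:R)).
Qed.

Lemma measurable_cutoff : measurable_fun setT cutoff.
Proof. by apply/measurable_EFinP; exact: measurable_int integrable_cutoff. Qed.

Lemma compact_box : compact (box a b).
Proof.
rewrite (_ : box a b = [set v | forall i, `[a 0 i, b 0 i]%classic (v ord0 i)]).
  apply: (@rV_compact R 3 (fun i => `[a 0 i, b 0 i]%classic)) => i.
  exact: segment_compact.
by apply/seteqP; split=> v Hv i; have := Hv i; rewrite /= in_itv.
Qed.

Lemma continuous_bounded_box (g : 'rV[R]_3 -> R) : continuous g ->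
  exists2 C : R, 0 <= C & forall p, `|cutoff p * g (vec3 p)| <= C * cutoff p.
Proof.
move=> cg.
have /compact_bounded[M [_ HM]] : compact (g @` box a b).
  by apply: continuous_compact compact_box; exact: continuous_subspaceT.
(* Boundedness gives a valid bound only for constants strictly above [M], hence the [+ 1]; the
   absolute value makes the constant nonnegative. *)
exists (`|M| + 1); first by rewrite addr_ge0.
move=> p; rewrite cutoffE indicE.
have [|_] := boolP (p \in _); last by rewrite mul0r mulr0 normr0.
rewrite inE => Dp; rewrite mul1r mulr1; apply: HM; first by rewrite ltr_pwDr// ler_norm.
by exists (vec3 p).
Qed.

Lemma measurable_vec3 (g : 'rV[R]_3 -> R) : continuous g ->
  measurable_fun setT (g \o vec3).
Proof.
move=> cg; apply: continuous_measurable_R3 => p.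
exact: (continuous_comp (@continuous_vec3 R p) (cg _)).
Qed.

Lemma integrable_box (g : 'rV[R]_3 -> R) : continuous g ->
  mu3.-integrable setT (EFin \o fun p => cutoff p * g (vec3 p)).
Proof.
move=> cg; have [C C0 HC] := continuous_bounded_box cg.
apply: le_integrable (integrableZl _ C integrable_cutoff) => //.
- apply/measurable_EFinP; apply: measurable_funM; first exact: measurable_cutoff.
  exact: measurable_vec3.
- move=> p _; rewrite /= lee_fin; apply: le_trans (HC p) _.
  exact: ler_norm.
Qed.

End Box.

Section Moments.
Context {R : realType}.
Implicit Types (q : 'rV[R]_3 -> R) (f : 'rV[R]_3 -> 'rV[R]_3 -> R).

Lemma admissible_decay (a b : 'rV[R]_3) f : admissible a b f ->
  forall k : nat, exists2 C : R, 0 <= C & forall x p,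
    `|vec3 p| ^+ k * `|f x (vec3 p)| <= C * weight p.
Proof. by move=> af; apply: decay_weight => k; exact: (adm_decay af [::] k). Qed.

Lemma admissible_continuous (a b : 'rV[R]_3) f : admissible a b f ->
  continuous (fun p : 'rV[R]_3 * 'rV[R]_3 => f p.1 p.2).
Proof. by move=> /adm_smooth /(_ [::])[]. Qed.

Lemma admissible_continuous_x (a b : 'rV[R]_3) f v : admissible a b f ->
  continuous (f^~ v).
Proof.
move=> af x; apply: (@continuous_comp _ _ _ (fun x => (x, v)) (fun p => f p.1 p.2)).
  by apply: continuous_pair; [apply: cvg_id|exact: cst_continuous].
exact: (admissible_continuous af).
Qed.

(** The decay of [f] absorbs the polynomial growth of [q]. Uniformity of [C] in [x] is what later
    yields joint integrability in [(x, v)]. *)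
Lemma moment_le (a b : 'rV[R]_3) f q (k : nat) (c : R) : admissible a b f ->
  (forall v, `|q v| <= c * `|v| ^+ k) ->
  exists C : R, forall x p, `|q (vec3 p) * f x (vec3 p)| <= C * weight p.
Proof.
move=> /admissible_decay /(_ k)[C C0 HC] qc; exists (`|c| * C) => x p.
rewrite normrM -mulrA.
apply: (@le_trans _ _ (`|c| * (`|vec3 p| ^+ k * `|f x (vec3 p)|))).
  rewrite mulrA ler_wpM2r//; apply: le_trans (qc _) _.
  by rewrite ler_wpM2r ?exprn_ge0// ler_norm.
by rewrite ler_wpM2l.
Qed.

Lemma integrable_moment (a b : 'rV[R]_3) f q (k : nat) (c : R) x :
  admissible a b f -> continuous q -> (forall v, `|q v| <= c * `|v| ^+ k) ->
  mu3.-integrable setT (EFin \o fun p => q (vec3 p) * f x (vec3 p)).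
Proof.
move=> af cq qc; have [C HC] := moment_le af qc.
apply: le_integrable (integrableZl _ C integrable_weight) => //.
- apply/measurable_EFinP; apply: measurable_funM; first exact: measurable_vec3.
  apply: (@measurable_vec3 _ (f x)) => v.
  apply: (@continuous_comp _ _ _ (fun v => (x, v)) (fun p => f p.1 p.2)).
    by apply: continuous_pair; [exact: (@cst_continuous _ _ x v)|apply: cvg_id].
  exact: (admissible_continuous af).
- move=> p _; rewrite /= lee_fin; apply: le_trans (HC x p) _.
  exact: ler_norm.
Qed.

(** The majorant is a product, [cutoff] in [x] times a multiple of [weight] in [v]. This is the
    integrability that allows the [x]- and [v]-integrals to be exchanged. *)
Lemma integrable_box_moment (a b : 'rV[R]_3) f q (k : nat) (c : R) :
  admissible a b f -> continuous q -> (forall v, `|q v| <= c * `|v| ^+ k) ->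
  (prod_measure mu3 mu3).-integrable setT
    (EFin \o fun z => cutoff a b z.1 * (q (vec3 z.2) * f (vec3 z.1) (vec3 z.2))).
Proof.
move=> af cq qc; have [C HC] := moment_le af qc.
have iC : mu3.-integrable setT (EFin \o fun p => C * weight p).
  exact: (integrableZl _ C (@integrable_weight R)).
apply: le_integrable (integrable_prodM (integrable_cutoff a b) iC) => //.
- apply/measurable_EFinP; apply: measurable_funM.
    exact: (measurableT_comp (measurable_cutoff a b) measurable_fst).
  apply: continuous_measurable_R3R3 => z.
  have c1 : {for z, continuous (fun z : (R * R * R) * (R * R * R) => vec3 z.1)}.
    exact: (@cvg_comp _ _ _ fst vec3 _ _ _ cvg_fst (@continuous_vec3 R z.1)).
  have c2 : {for z, continuous (fun z : (R * R * R) * (R * R * R) => vec3 z.2)}.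
    exact: (@cvg_comp _ _ _ snd vec3 _ _ _ cvg_snd (@continuous_vec3 R z.2)).
  apply: continuousM; first exact: (@continuous_comp _ _ _ _ q _ c2 (cq _)).
  apply: (@continuous_comp _ _ _
    (fun z : (R * R * R) * (R * R * R) => (vec3 z.1, vec3 z.2))
    (fun p => f p.1 p.2)).
    exact: continuous_pair.
  exact: (admissible_continuous af).
- move=> z _; rewrite /= lee_fin [leLHS]normrM [leRHS]normrM.
  by rewrite ler_wpM2l//; apply: le_trans (HC _ _) _; exact: ler_norm.
Qed.

End Moments.

(** * Derivatives of periodic functions *)

Section PeriodicDerivative.
Context {R : realType}.
Local Notation leb := (@lebesgue_measure R).

(** Both derivatives have literally the same difference quotient, which is the equality [E]. *)
Lemma is_derive_line (V : normedModType R) (g : V -> R) (v e : V) (t : R) :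
  derivable g (v + t *: e) e ->
  is_derive t 1 (fun s => g (v + s *: e)) ('D_e g (v + t *: e)).
Proof.
have E : (fun h : R => h^-1 *: (((fun s => g (v + s *: e)) \o shift t) (h *: 1) -
      g (v + t *: e))) =
    (fun h => h^-1 *: ((g \o shift (v + t *: e)) (h *: e) - g (v + t *: e))).
  by apply/funext => h /=; rewrite [h *: 1]mulr1 scalerDl addrCA.
by move=> dg; split; rewrite /derivable /derive E.
Qed.

Lemma continuous_line (V : normedModType R) (g : V -> R) (v e : V) :
  continuous g -> continuous (fun s : R => g (v + s *: e)).
Proof.
move=> cg t; apply: (@continuous_comp _ _ _ (fun s : R => v + s *: e) g).
  apply: continuousD; first exact: cst_continuous.
  exact: scalel_continuous.
exact: cg.
Qed.

Variables a b : 'rV[R]_3.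
Hypothesis box_ab : forall i, a 0 i < b 0 i.

(** By the fundamental theorem of calculus the integral is the difference of the values of [g] at
    two points one period apart. *)
Lemma integral_partial_line (g : 'rV[R]_3 -> R) (d : 'I_3) (v : 'rV[R]_3) :
  periodic a b g -> (forall x, derivable g x (basis d)) ->
  continuous (partial d g) ->
  (\int[leb]_(t in side a b d) (partial d g (v + t *: basis d))%:E = 0)%E.
Proof.
move=> pg dg cg; pose F t := g (v + t *: basis d).
have dF (t : R) : is_derive t 1 F (partial d g (v + t *: basis d)).
  exact: is_derive_line.
have cF : continuous F.
  by move=> t; apply/differentiable_continuous/derivable1_diffP; have [] := dF t.
rewrite (@continuous_FTC2 _ _ F)//.
- rewrite -EFinB; congr EFin; apply/eqP; rewrite subr_eq0; apply/eqP.
  by rewrite /F -[RHS](pg d) -addrA -scalerDl subrKC.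
- by apply: continuous_subspaceT; apply: continuous_line; exact: cg.
- split; first by move=> t _; have [] := dF t.
  + by apply: cvg_at_right_filter; exact: cF.
  + by apply: cvg_at_left_filter; exact: cF.
- by move=> t _; rewrite derive1E; have [] := dF t.
Qed.

(** In the applications [c] is the product of the indicators of the other two sides, so that
    [c * \1_(side a b d) t] is a slice of [cutoff]. *)
Lemma integral_side_eq0 (d : 'I_3) (c : R) (h : R -> R) : continuous h ->
  (\int[leb]_(t in side a b d) (h t)%:E = 0)%E ->
  (\int[leb]_t ((c * \1_(side a b d) t) * h t)%:E = 0)%E.
Proof.
move=> ch h0; transitivity (\int[leb]_(t in side a b d) (c%:E * (h t)%:E))%E.
  rewrite [RHS]integral_mkcond; apply: eq_integral => t _.
  rewrite patchE indicE; case: (t \in _); first by rewrite mulr1.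
  by rewrite mulr0 mul0r.
rewrite integralZl ?h0 ?mule0//; first exact: measurable_itv.
apply: continuous_compact_integrable; first exact: segment_compact.
exact: continuous_subspaceT.
Qed.

Section Slices.
Variables (F : R * R * R -> R) (C : R).
Hypothesis mF : measurable_fun setT F.
Hypothesis FC : forall p, `|F p| <= C * cutoff a b p.

Let iF : mu3.-integrable setT (EFin \o F).
Proof.
apply: le_integrable (integrableZl _ C (integrable_cutoff a b)) => //.
  exact/measurable_EFinP.
by move=> p _; rewrite /= lee_fin; apply: le_trans (FC p) _; exact: ler_norm.
Qed.

(** Bounding the third indicator by 1 gives integrability of the slice for every [z], where Fubini
    alone would give it for almost every [z]. *)
Let iFz z : (prod_measure leb leb).-integrable setT (EFin \o fun q => F (q, z)).
Proof.
have H d : leb.-integrable setT (EFin \o \1_(side a b d)) by exact: integrable_indic_itv.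
apply: le_integrable (integrableZl _ C (integrable_prodM (H 0) (H 1))) => //.
  by apply/measurable_EFinP; exact: measurableT_comp mF (measurable_pair2 z).
move=> q _; rewrite /= lee_fin; apply: le_trans (FC _) _.
apply: le_trans (ler_norm _) _; rewrite !normrM ler_wpM2l//=.
rewrite -[leRHS]mulr1 ler_wpM2l ?mulr_ge0//.
by rewrite indicE; case: (_ \in _); rewrite /= ?normr1 ?normr0.
Qed.

(** The product is nested as [(leb \x leb) \x leb]: the third coordinate becomes innermost with one
    use of Fubini, while the other two require a second use inside the slice at fixed [z]. *)
Lemma integral_slice2_eq0 :
  (forall x y, \int[leb]_z (F (x, y, z))%:E = 0)%E ->
  (\int[mu3]_p (F p)%:E = 0)%E.
Proof.
move=> F0.
rewrite -[LHS](@integral12_prod_meas1 _ _ _ _ _ (prod_measure leb leb) leb _ iF).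
by apply: integral0_eq => -[x y] _; exact: F0.
Qed.

Lemma integral_slice1_eq0 :
  (forall x z, \int[leb]_y (F (x, y, z))%:E = 0)%E ->
  (\int[mu3]_p (F p)%:E = 0)%E.
Proof.
move=> F0.
rewrite -[LHS](@integral21_prod_meas1 _ _ _ _ _ (prod_measure leb leb) leb _ iF).
apply: integral0_eq => z _.
transitivity (\int[prod_measure leb leb]_q (F (q, z))%:E)%E => //.
rewrite -[LHS](@integral12_prod_meas1 _ _ _ _ _ leb leb _ (iFz z)).
by apply: integral0_eq => x _; exact: F0.
Qed.

Lemma integral_slice0_eq0 :
  (forall y z, \int[leb]_x (F (x, y, z))%:E = 0)%E ->
  (\int[mu3]_p (F p)%:E = 0)%E.
Proof.
move=> F0.
rewrite -[LHS](@integral21_prod_meas1 _ _ _ _ _ (prod_measure leb leb) leb _ iF).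
apply: integral0_eq => z _.
transitivity (\int[prod_measure leb leb]_q (F (q, z))%:E)%E => //.
rewrite -[LHS](@integral21_prod_meas1 _ _ _ _ _ leb leb _ (iFz z)).
by apply: integral0_eq => x _; exact: F0.
Qed.

End Slices.

(** The integration along the [d]-th axis is done first; periodicity makes each of these line
    integrals vanish. *)
Lemma int3_partial_eq0 (g : 'rV[R]_3 -> R) (d : 'I_3) :
  periodic a b g -> (forall x, derivable g x (basis d)) ->
  continuous (partial d g) -> int3 (box a b) (partial d g) = 0.
Proof.
move=> pg dg cg; rewrite int3_box /Rintegral.
have [C _ HC] := continuous_bounded_box a b cg.
have mF : measurable_fun setT (fun p => cutoff a b p * partial d g (vec3 p)).
  by apply: measurable_funM; [exact: measurable_cutoff|exact: measurable_vec3].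
have line v c : (\int[leb]_t ((c * \1_(side a b d) t) *
    partial d g (v + t *: basis d))%:E = 0)%E.
  apply: integral_side_eq0; first exact: continuous_line.
  exact: integral_partial_line.
(* The lines below start at a point whose [d]-th coordinate is 0, so that the parameter [t] is the
   [d]-th coordinate itself. *)
have vE (x y z : R) : vec3 (x, y, z) = x *: basis 0 + y *: basis 1 + z *: basis 2%:R.
  apply/rowP => i; rewrite !mxE /=.
  by case: i => [[|[|[|//]]] ?] /=; rewrite !mulr0 !mulr1 ?addr0 ?add0r.
suff -> : (\int[mu3]_p (cutoff a b p * partial d g (vec3 p))%:E = 0)%E by [].
have [dE|dE|dE] := I3P d.
- apply: (integral_slice0_eq0 mF HC) => y z.
  rewrite -[RHS](line (vec3 (0, y, z)) (\1_(side a b 1) y * \1_(side a b 2%:R) z)).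
  apply: eq_integral => x _; congr ((_ * partial d g _)%:E).
    by rewrite /cutoff dE /=; ring.
  by rewrite !vE dE scale0r add0r [RHS]addrC addrA.
- apply: (integral_slice1_eq0 mF HC) => x z.
  rewrite -[RHS](line (vec3 (x, 0, z)) (\1_(side a b 0) x * \1_(side a b 2%:R) z)).
  apply: eq_integral => y _; congr ((_ * partial d g _)%:E).
    by rewrite /cutoff dE /=; ring.
  by rewrite !vE dE scale0r addr0 addrAC.
- apply: (integral_slice2_eq0 mF HC) => x y.
  rewrite -[RHS](line (vec3 (x, y, 0)) (\1_(side a b 0) x * \1_(side a b 1) y)).
  apply: eq_integral => z _; congr ((_ * partial d g _)%:E).
    by rewrite /cutoff dE.
  by rewrite !vE dE scale0r addr0.
Qed.

End PeriodicDerivative.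

(** * Transport step *)

Section Transport.
Context {R : realType}.
Variables a b : 'rV[R]_3.
Implicit Types (q : 'rV[R]_3 -> R) (f : 'rV[R]_3 -> 'rV[R]_3 -> R).

Lemma EFin_Rintegral d (T : measurableType d) (mu : {measure set T -> \bar R})
    (g : T -> R) : mu.-integrable setT (EFin \o g) ->
  (\int[mu]_x (g x)%:E)%E = (Rintegral mu setT g)%:E.
Proof. by move=> ig; rewrite /Rintegral fineK//; exact: integrable_fin_num ig. Qed.

(** An equality of functions, valid at every point, because it serves twice: for the integrability
    of the moment in [x] and for the value of the iterated integral. *)
Lemma box_moment_fubini_F f q (k : nat) (c : R) : admissible a b f ->
  continuous q -> (forall v, `|q v| <= c * `|v| ^+ k) ->
  fubini_F mu3 (EFin \o fun z => cutoff a b z.1 *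
      (q (vec3 z.2) * f (vec3 z.1) (vec3 z.2))) =
  EFin \o fun p => cutoff a b p * int3 setT (fun v => q v * f (vec3 p) v).
Proof.
move=> af cq qc; apply/funext => p; rewrite /fubini_F /=.
have ip := integrable_moment (vec3 p) af cq qc.
rewrite [LHS](@EFin_Rintegral _ _ mu3 
  (fun r => cutoff a b p * (q (vec3 r) * f (vec3 p) (vec3 r)))).
  by congr EFin; exact: (RintegralZl _ measurableT ip).
exact: (integrableZl _ (cutoff a b p) ip).
Qed.

Lemma integrable_box_int3 f q (k : nat) (c : R) : admissible a b f ->
  continuous q -> (forall v, `|q v| <= c * `|v| ^+ k) ->
  mu3.-integrable setT
    (EFin \o fun p => cutoff a b p * int3 setT (fun v => q v * f (vec3 p) v)).
Proof.
move=> af cq qc; rewrite -(box_moment_fubini_F af cq qc).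
exact: (integrable_fubini_F (integrable_box_moment af cq qc)).
Qed.

Lemma int3_box_moment f q (k : nat) (c : R) : admissible a b f ->
  continuous q -> (forall v, `|q v| <= c * `|v| ^+ k) ->
  int3 (box a b) (fun x => int3 setT (fun v => q v * f x v)) =
  Rintegral (prod_measure mu3 mu3) setT (fun z => cutoff a b z.1 *
      (q (vec3 z.2) * f (vec3 z.1) (vec3 z.2))).
Proof.
move=> af cq qc; rewrite int3_box /Rintegral.
rewrite -(@integral12_prod_meas1 _ _ _ _ _ mu3 mu3 _ (integrable_box_moment af cq qc)).
congr fine; apply: eq_integral => p _.
exact: (esym (congr1 (@^~ p) (box_moment_fubini_F af cq qc))).
Qed.

Definition box_integrable (g : 'rV[R]_3 -> R) :=
  mu3.-integrable setT (EFin \o fun p => cutoff a b p * g (vec3 p)).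

Lemma box_integrableD g h : box_integrable g -> box_integrable h ->
  box_integrable (fun x => g x + h x).
Proof.
move=> ig ih; apply: eq_integrable (integrableD measurableT ig ih) => // p _.
by rewrite /= mulrDr.
Qed.

Lemma box_integrableZ (c : R) g : box_integrable g ->
  box_integrable (fun x => c * g x).
Proof.
move=> ig; apply: eq_integrable (integrableZl measurableT c ig) => // p _.
by rewrite /= -EFinM mulrCA.
Qed.

Lemma box_integrable_sum (I : Type) (s : seq I) (h : I -> 'rV[R]_3 -> R) :
  (forall i, box_integrable (h i)) ->
  box_integrable (fun x => \sum_(i <- s) h i x).
Proof.
move=> ih; have := integrable_sum measurableT s (P := xpredT) (fun i _ => ih i).
by apply: eq_integrable => // p _; rewrite /= sumEFin mulr_sumr.
Qed.

Lemma int3_boxD g h : box_integrable g -> box_integrable h ->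
  int3 (box a b) (fun x => g x + h x) = int3 (box a b) g + int3 (box a b) h.
Proof.
move=> ig ih; rewrite !int3_box -RintegralD//.
by congr Rintegral; apply/funext => p; rewrite mulrDr.
Qed.

Lemma int3_boxZ (c : R) g : box_integrable g ->
  int3 (box a b) (fun x => c * g x) = c * int3 (box a b) g.
Proof.
move=> ig; rewrite !int3_box -RintegralZl//.
by congr Rintegral; apply/funext => p; rewrite mulrCA.
Qed.

Lemma int3_box_sum (I : Type) (s : seq I) (h : I -> 'rV[R]_3 -> R) :
  (forall i, box_integrable (h i)) ->
  int3 (box a b) (fun x => \sum_(i <- s) h i x) =
  \sum_(i <- s) int3 (box a b) (h i).
Proof.
move=> ih; elim: s => [|i s IHs].
  (* The zero integrand is treated as 0 times the integrable [cutoff], so that linearity gives its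
     integral. *)
  rewrite big_nil int3_box -[RHS](mul0r (Rintegral mu3 setT (cutoff a b))).
  rewrite -RintegralZl//; last exact: integrable_cutoff.
  by congr Rintegral; apply/funext => p; rewrite big_nil mulr0 mul0r.
rewrite big_cons -IHs -int3_boxD//; last exact: box_integrable_sum.
by congr int3; apply/funext => x; rewrite big_cons.
Qed.

(** A partial derivative in [x] at fixed [v] is the derivative of the joint function in the
    direction [(basis d, 0)], to which joint smoothness applies. *)
Lemma admissible_partial f (d : 'I_3) (v : 'rV[R]_3) : admissible a b f ->
  (forall x, derivable (f^~ v) x (basis d)) /\ continuous (partial d (f^~ v)).
Proof.
move=> /adm_smooth sf.
pose F (p : 'rV[R]_3 * 'rV[R]_3) := f p.1 p.2.
have E x : (fun h : R => h^-1 *: (((f^~ v) \o shift x) (h *: basis d) - f x v)) =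
    (fun h => h^-1 *: ((F \o shift (x, v)) (h *: (basis d, 0)) - F (x, v))).
  by apply/funext => h /=; rewrite /F /= scaler0 add0r.
split=> [x|].
  by rewrite /derivable E; exact: (sf [::]).2.
have -> : partial d (f^~ v) = (fun x => 'D_(basis d, 0) F (x, v)).
  by apply/funext => x; rewrite /partial /derive E.
have [cF _] := sf [:: (basis d, 0)].
move=> x; apply: (@continuous_comp _ _ _ (fun x => (x, v)) _ _ _ (cF _)).
apply: continuous_pair; [apply: cvg_id|exact: cst_continuous].
Qed.

Hypothesis box_ab : forall i, a 0 i < b 0 i.

(** At fixed [v] the factors [v 0 d] are constants, and each partial derivative of the periodic
    function [f^~ v] has integral 0 over the box. *)
Lemma transport_int3_box_slice f fs (dt : R) (v : 'rV[R]_3) :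
  admissible a b f ->
  (forall x, fs x v = f x v - dt * \sum_(d < 3) v 0 d * partial d (f^~ v) x) ->
  int3 (box a b) (fs^~ v) = int3 (box a b) (f^~ v).
Proof.
move=> af fsE.
have ipart d : box_integrable (partial d (f^~ v)).
  by apply: integrable_box; have [] := admissible_partial d v af.
have isum : box_integrable (fun x => \sum_(d < 3) v 0 d * partial d (f^~ v) x).
  by apply: box_integrable_sum => d; exact: box_integrableZ.
have iff : box_integrable (f^~ v).
  by apply: integrable_box; exact: admissible_continuous_x af.
have -> : fs^~ v = fun x => f x v + (- dt) * \sum_(d < 3) v 0 d * partial d (f^~ v) x.
  by apply/funext => x; rewrite fsE mulNr.
rewrite int3_boxD//; last exact: box_integrableZ.
rewrite int3_boxZ// int3_box_sum => [|d]; last exact: box_integrableZ.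
rewrite big1 ?mulr0 ?addr0// => d _.
have [dp cp] := admissible_partial d v af.
rewrite int3_boxZ// int3_partial_eq0 ?mulr0//.
by move=> i x; rewrite (adm_periodic af).
Qed.

(** Fubini is applied to [f] and to [fs] separately, never to the flux. Once the [x]-integral is
    innermost, [q] is a constant factor and the slices agree for every [v]. *)
Lemma transport_int3_box_moment f fs (dt : R) q (k : nat) (c : R) :
  admissible a b f -> admissible a b fs ->
  continuous q -> (forall v, `|q v| <= c * `|v| ^+ k) ->
  (forall x v, fs x v = f x v - dt * \sum_(d < 3) v 0 d * partial d (f^~ v) x) ->
  int3 (box a b) (fun x => int3 setT (fun v => q v * fs x v)) =
  int3 (box a b) (fun x => int3 setT (fun v => q v * f x v)).
Proof.
move=> af afs cq qc fsE.
rewrite (int3_box_moment af cq qc) (int3_box_moment afs cq qc) /Rintegral.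
rewrite -(@integral21_prod_meas1 _ _ _ _ _ mu3 mu3 _ (integrable_box_moment af cq qc)).
rewrite -(@integral21_prod_meas1 _ _ _ _ _ mu3 mu3 _ (integrable_box_moment afs cq qc)).
congr fine; apply: eq_integral => r _; rewrite /fubini_G /=.
have slice g : admissible a b g ->
    (\int[mu3]_p (cutoff a b p * (q (vec3 r) * g (vec3 p) (vec3 r)))%:E =
    (q (vec3 r) * int3 (box a b) (g^~ (vec3 r)))%:E)%E.
  move=> ag.
  have ig : box_integrable (g^~ (vec3 r)).
    by apply: integrable_box; exact: admissible_continuous_x ag.
  rewrite EFin_Rintegral; last exact: (box_integrableZ (q (vec3 r)) ig).
  rewrite -(int3_boxZ (q (vec3 r)) ig); congr EFin.
  exact: (esym (int3_box a b (fun x => q (vec3 r) * g x (vec3 r)))).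
by rewrite !slice// (transport_int3_box_slice (fs := fs) (dt := dt) af).
Qed.

End Transport.

(** * Electromagnetic fields and the Lorentz step *)

Section VectorAlgebra.
Context {R : realType}.
Implicit Types u v w : 'rV[R]_3.

Lemma sum3 (h : 'I_3 -> R) : \sum_(i < 3) h i = h 0 + h 1 + h 2%:R.
Proof.
rewrite !big_ord_recl big_ord0 addr0 addrA.
by congr (h _ + h _ + h _); exact: val_inj.
Qed.

Lemma sum_levi_civita (d : 'I_3) (h : 'I_3 -> 'I_3 -> R) :
  \sum_(l < 3) \sum_(m < 3) levi_civita d l m * h l m =
  h (d + 1) (d + 2%:R) - h (d + 2%:R) (d + 1).
Proof.
by have [->|->|->] := I3P d; rewrite !sum3 /levi_civita !I3E /=;
  rewrite !(mul0r, mul1r, mulN1r, add0r, addr0)// addrC.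
Qed.

Lemma crossE u v d :
  cross u v 0 d = u 0 (d + 1) * v 0 (d + 2%:R) - u 0 (d + 2%:R) * v 0 (d + 1).
Proof.
rewrite mxE -(sum_levi_civita d (fun l m => u 0 l * v 0 m)).
by apply: eq_bigr => l _; apply: eq_bigr => m _; rewrite mulrA.
Qed.

Lemma curlE (F : 'rV[R]_3 -> 'rV[R]_3) x d :
  curl F x 0 d = partial (d + 1) (fun y => F y 0 (d + 2%:R)) x
    - partial (d + 2%:R) (fun y => F y 0 (d + 1)) x.
Proof.
by rewrite mxE (sum_levi_civita d (fun l m => partial l (fun y => F y 0 m) x)).
Qed.

Lemma dot_sub_sqr u v : dot u u - dot v v = dot (u - v) (u + v).
Proof. by rewrite /dot !sum3 !mxE; ring. Qed.

Lemma dotC u v : dot u v = dot v u.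
Proof. by rewrite /dot; apply: eq_bigr => i _; rewrite mulrC. Qed.

Lemma dotDl u v w : dot (u + v) w = dot u w + dot v w.
Proof. by rewrite /dot !sum3 !mxE; ring. Qed.

Lemma dotDr u v w : dot u (v + w) = dot u v + dot u w.
Proof. by rewrite dotC dotDl !(dotC _ u). Qed.

Lemma dotZl (c : R) u v : dot (c *: u) v = c * dot u v.
Proof. by rewrite /dot !sum3 !mxE; ring. Qed.

Lemma dot_cross u v : dot (cross u v) u = 0.
Proof. by rewrite /dot !sum3 !crossE !I3E; ring. Qed.

(** The norm is the maximum of the absolute values of the coordinates, hence the factor 3. This is
    the growth bound that lets the moment lemmas apply to the energy. *)
Lemma dot_sqr_le v : `|dot v v| <= 3 * `|v| ^+ 2.
Proof.
have H i : v 0 i * v 0 i <= `|v| ^+ 2.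
  by rewrite -expr2 -(ger0_norm (sqr_ge0 _)) normrX lerXn2r ?nnegrE// normr_coord_le.
rewrite ger0_norm; last by apply: sumr_ge0 => i _; rewrite -expr2 sqr_ge0.
by rewrite /dot sum3; move: (H 0) (H 1) (H 2%:R); lra.
Qed.

End VectorAlgebra.

Section Fields.
Context {R : realType}.
Variables a b : 'rV[R]_3.
Implicit Types (g h : 'rV[R]_3 -> R) (E B : 'rV[R]_3 -> 'rV[R]_3).

Lemma smooth_partial g d : smooth g ->
  [/\ continuous g, forall x, derivable g x (basis d) & continuous (partial d g)].
Proof.
move=> sg; split; [exact: (sg [::]).1| |exact: (sg [:: basis d]).1].
by move=> x; exact: (sg [::]).2.
Qed.

Lemma partialM g h d x : derivable g x (basis d) -> derivable h x (basis d) ->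
  partial d (fun y => g y * h y) x = g x * partial d h x + h x * partial d g x.
Proof. by move=> dg dh; exact: (deriveM dg dh). Qed.

Lemma continuous_partialM g h d : smooth g -> smooth h ->
  continuous (partial d (fun y => g y * h y)).
Proof.
move=> /(smooth_partial d)[cg dg cpg] /(smooth_partial d)[ch dh cph].
rewrite (_ : partial _ _ = fun x => g x * partial d h x + h x * partial d g x).
  by move=> x; exact: (continuousD (continuousM (cg x) (cph x))
    (continuousM (ch x) (cpg x))).
by apply/funext => x; rewrite partialM.
Qed.

Lemma periodic_coord E i : periodic a b E -> periodic a b (fun x => E x 0 i).
Proof. by move=> pE d x; rewrite pE. Qed.

Lemma int3_partialM_eq0 E B i j d : (forall i, a 0 i < b 0 i) ->
  smooth_periodic_field a b E -> smooth_periodic_field a b B ->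
  int3 (box a b) (partial d (fun y => E y 0 i * B y 0 j)) = 0.
Proof.
move=> ab [sE pE] [sB pB]; apply: int3_partial_eq0 => //.
- by move=> d' x; rewrite (periodic_coord i pE) (periodic_coord j pB).
- move=> x; have [_ dE _] := smooth_partial d (sE i).
  by have [_ dB _] := smooth_partial d (sB j); exact: derivableM.
- exact: continuous_partialM.
Qed.

(** The divergence of [cross B E], expanded into partial derivatives of products of two scalar
    components, each of which integrates to 0 by periodicity. *)
Definition div_cross B E x : R := \sum_(d < 3)
  (partial d (fun y => B y 0 (d + 1) * E y 0 (d + 2%:R)) x
   + (- 1) * partial d (fun y => B y 0 (d + 2%:R) * E y 0 (d + 1)) x).

Lemma div_crossE B E x :
  smooth_periodic_field a b B -> smooth_periodic_field a b E ->
  div_cross B E x = dot (curl B x) (E x) - dot (B x) (curl E x).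
Proof.
move=> [sB _] [sE _].
pose pB i d := partial d (fun y => B y 0 i) x.
pose pE i d := partial d (fun y => E y 0 i) x.
have D i j d : partial d (fun y => B y 0 i * E y 0 j) x =
    B x 0 i * pE j d + E x 0 j * pB i d.
  have [_ dB _] := smooth_partial d (sB i).
  by have [_ dE _] := smooth_partial d (sE j); rewrite partialM.
have cB d : curl B x 0 d = pB (d + 2) (d + 1) - pB (d + 1) (d + 2) by exact: curlE.
have cE d : curl E x 0 d = pE (d + 2) (d + 1) - pE (d + 1) (d + 2) by exact: curlE.
(* With the partial derivatives as opaque atoms, the product rule leaves a polynomial identity. *)
clearbody pB pE; rewrite /div_cross /dot !sum3 !D !cB !cE !I3E; ring.
Qed.

Lemma div_cross_box B E : (forall i, a 0 i < b 0 i) ->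
  smooth_periodic_field a b B -> smooth_periodic_field a b E ->
  box_integrable a b (div_cross B E) /\ int3 (box a b) (div_cross B E) = 0.
Proof.
move=> ab sB sE.
have ip i j d : box_integrable a b (partial d (fun y => B y 0 i * E y 0 j)).
  by apply: integrable_box; apply: continuous_partialM; [exact: sB.1|exact: sE.1].
have id d : box_integrable a b (fun x =>
    partial d (fun y => B y 0 (d + 1) * E y 0 (d + 2%:R)) x
   + (- 1) * partial d (fun y => B y 0 (d + 2%:R) * E y 0 (d + 1)) x).
  by apply: box_integrableD => //; exact: box_integrableZ.
split; first exact: box_integrable_sum.
rewrite int3_box_sum// big1// => d _.
rewrite int3_boxD//; last exact: box_integrableZ.
by rewrite int3_boxZ// !int3_partialM_eq0// mulr0 addr0.
Qed.

Lemma continuous_dot E B : (forall i, continuous (fun x => E x 0 i)) ->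
  (forall i, continuous (fun x => B x 0 i)) -> continuous (fun x => dot (E x) (B x)).
Proof.
move=> cE cB; rewrite (_ : (fun _ => _) = fun x =>
    E x 0 0 * B x 0 0 + E x 0 1 * B x 0 1 + E x 0 2%:R * B x 0 2%:R).
  move=> x; have cEB i := continuousM (cE i x) (cB i x).
  exact: (continuousD (continuousD (cEB 0) (cEB 1)) (cEB 2%:R)).
by apply/funext => x; rewrite /dot sum3.
Qed.

Lemma box_integrable_dot E B : smooth_periodic_field a b E ->
  smooth_periodic_field a b B -> box_integrable a b (fun x => dot (E x) (B x)).
Proof.
move=> [sE _] [sB _]; apply: integrable_box; apply: continuous_dot => i.
- by have [] := smooth_partial 0 (sE i).
- by have [] := smooth_partial 0 (sB i).
Qed.

End Fields.

(** * Fluid energy and current as velocity moments *)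

Section Macroscopic.
Context {R : realType}.
Variables a b : 'rV[R]_3.
Implicit Types f : 'rV[R]_3 -> 'rV[R]_3 -> R.

Definition fluid_energy f x : R :=
  density f x * (dot (velocity f x) (velocity f x) + 3 * temperature f x).

(** The division by [3 * density f x] in [temperature] cancels since the density is positive. *)
Lemma fluid_energyE f : admissible a b f ->
  fluid_energy f = fun x => int3 setT (fun v => dot v v * f x v).
Proof. move=> /adm_density rho; apply/funext => x; have /lt0r_neq0 rho0 := rho x.
by rewrite /fluid_energy /temperature; field. Qed.

Lemma momentumE f x : 0 < density f x -> momentum f x = density f x *: velocity f x.
Proof. by move=> /lt0r_neq0 ?; rewrite /velocity scalerA divff// scale1r. Qed.

Lemma currentE fs f x : admissible a b fs -> admissible a b f ->
  current fs f x = 2^-1 *: (momentum fs x + momentum f x).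
Proof.
move=> afs af; apply/rowP => i; rewrite !mxE.
have cq : continuous (fun v : 'rV[R]_3 => v 0 i) by exact: coord_continuous.
have qc (v : 'rV[R]_3) : `|v 0 i| <= 1 * `|v| ^+ 1 by rewrite mul1r expr1 normr_coord_le.
have ifs := integrable_moment x afs cq qc.
have if1 := integrable_moment x af cq qc.
rewrite /int3 -(@RintegralD _ _ _ mu3 setT _ _ measurableT ifs if1).
rewrite -[RHS](@RintegralZl _ _ _ mu3 setT _ 2^-1 measurableT
  (integrableD measurableT ifs if1)).
by congr Rintegral; apply/funext => p /=; ring.
Qed.

Lemma continuous_dot_sqr : continuous (fun v : 'rV[R]_3 => dot v v).
Proof. by apply: continuous_dot => i; exact: coord_continuous. Qed.

End Macroscopic.

Lemma scaler_solve (R : realType) (V : lmodType R) (c : R) (u w : V) :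
  c != 0 -> c^-1 *: u = w -> u = c *: w.
Proof. by move=> c0 <-; rewrite scalerA divff// scale1r. Qed.

(** * Energy balance over one step of the scheme *)

Section Step.
Context {R : realType}.
Variables (M : nat) (dt : R) (a b : 'rV[R]_3).
Variables (f0 fs f1 : 'rV[R]_3 -> 'rV[R]_3 -> R).
Variables (E0 E1 B0 Bh B1 : 'rV[R]_3 -> 'rV[R]_3).
Hypothesis dt_gt0 : 0 < dt.
Hypothesis box_ab : forall i, a 0 i < b 0 i.
Hypothesis af0 : admissible a b f0.
Hypothesis afs : admissible a b fs.
Hypothesis af1 : admissible a b f1.
Hypothesis sE0 : smooth_periodic_field a b E0.
Hypothesis sE1 : smooth_periodic_field a b E1.
Hypothesis sBh : smooth_periodic_field a b Bh.
Hypothesis step : schemeII_step M dt f0 fs f1 E0 E1 B0 Bh B1.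

Lemma int3_transport_energy :
  int3 (box a b) (fluid_energy fs) = int3 (box a b) (fluid_energy f0).
Proof.
rewrite (fluid_energyE afs) (fluid_energyE af0).
apply: (transport_int3_box_moment box_ab (dt := dt) af0 afs
  continuous_dot_sqr (@dot_sqr_le R)).
move=> x v; have := step_transport step x v.
move=> /(congr1 ( *%R dt)); rewrite mulrC divfK ?gt_eqF// mulrN => <-.
by rewrite addrC subrK.
Qed.

(** Density and temperature are frozen, so only [|u|^2] changes, by the product of [u1 - us] and
    [u1 + us]. The velocity update replaces the first factor, and half the density times the second
    is the current. *)
Lemma lorentz_energyE x :
  fluid_energy f1 x - fluid_energy fs x = dt * dot (current fs f1 x) (E0 x + E1 x).
Proof.
have dt0 := lt0r_neq0 dt_gt0.
rewrite /fluid_energy (step_density step) (step_temperature step).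
rewrite -mulrBr opprD addrACA subrr addr0 dot_sub_sqr.
rewrite (scaler_solve dt0 (step_velocity step x)) dotZl dotDl.
set us := velocity fs x; set u1 := velocity f1 x.
have -> : dot (cross (2^-1 *: (us + u1)) (Bh x)) (u1 + us) = 0.
  have -> : u1 + us = 2 *: (2^-1 *: (us + u1)).
    by rewrite scalerA divff// scale1r addrC.
  by rewrite dotC dotZl dotC dot_cross mulr0.
rewrite (currentE x afs af1) !momentumE ?(adm_density afs)// ?(adm_density af1)//.
rewrite (step_density step) -scalerDr !dotZl dotC (addrC u1).
by rewrite -/us -/u1; ring.
Qed.

Lemma field_energyE (Bm Bp : 'rV[R]_3 -> 'rV[R]_3) x :
  (dt / 2)^-1 *: (B0 x - Bm x) = - curl E0 x ->
  (dt / 2)^-1 *: (Bp x - B1 x) = - curl E1 x ->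
  (dot (E1 x) (E1 x) + dot (Bp x) (Bh x)) - (dot (E0 x) (E0 x) + dot (Bh x) (Bm x))
  = dt * (dot (curl Bh x) (E0 x + E1 x) - dot (Bh x) (curl E0 x + curl E1 x)
          - dot (current fs f1 x) (E0 x + E1 x)).
Proof.
move=> B0m Bp1; have dt0 := lt0r_neq0 dt_gt0.
have dt20 : dt / 2 != 0 by rewrite mulf_neq0// invr_eq0.
(* The half steps on both sides of [B1] use the same [curl E1], so they add up to one full step;
   likewise around [B0] with [curl E0] below. *)
have BpE : Bp x = Bh x - dt *: curl E1 x.
  rewrite -(subrK (B1 x) (Bp x)) (scaler_solve dt20 Bp1).
  rewrite -(subrK (Bh x) (B1 x)) (scaler_solve dt20 (step_faraday step x)).
  by rewrite addrA -scalerDl -splitr scalerN addrC.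
have BmE : Bm x = Bh x + dt *: curl E0 x.
  apply/esym; rewrite -(subrK (B0 x) (Bh x)).
  rewrite (scaler_solve dt20 (step_faraday_half step x)).
  rewrite -(subrK (Bm x) (B0 x)) (scaler_solve dt20 B0m).
  by rewrite addrA -scalerDl -splitr scalerN addrAC addNr add0r.
transitivity (dot (E1 x - E0 x) (E1 x + E0 x) - dt * dot (Bh x) (curl E0 x + curl E1 x)).
  rewrite -dot_sub_sqr BpE BmE -[- (dt *: _)]scaleNr !dotDl !dotDr !dotZl.
  by rewrite (dotC (Bh x) (_ *: _)) dotZl
    (dotC (curl E1 x) (Bh x)) (dotC (curl E0 x) (Bh x)); ring.
rewrite (scaler_solve dt0 (step_ampere step x)) dotZl (addrC (E1 x)).
by rewrite dotDl -[- current fs f1 x]scaleN1r dotZl; ring.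
Qed.

Lemma step_total_energy (Bm Bp : 'rV[R]_3 -> 'rV[R]_3) :
  smooth_periodic_field a b Bm -> smooth_periodic_field a b Bp ->
  (forall x, (dt / 2)^-1 *: (B0 x - Bm x) = - curl E0 x) ->
  (forall x, (dt / 2)^-1 *: (Bp x - B1 x) = - curl E1 x) ->
  total_energy a b f0 E0 Bm Bh = total_energy a b f1 E1 Bh Bp.
Proof.
move=> sBm sBp B0m Bp1.
pose W0 x := dot (E0 x) (E0 x) + dot (Bh x) (Bm x).
pose W1 x := dot (E1 x) (E1 x) + dot (Bp x) (Bh x).
suff H : int3 (box a b) (fluid_energy f0) + int3 (box a b) W0 =
    int3 (box a b) (fluid_energy f1) + int3 (box a b) W1.
  by have := congr1 ( *%R 2^-1) H; rewrite !mulrDr.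
have iW0 : box_integrable a b W0.
  by apply: box_integrableD; exact: box_integrable_dot.
have iW1 : box_integrable a b W1.
  by apply: box_integrableD; exact: box_integrable_dot.
have iEs : box_integrable a b (fluid_energy fs).
  rewrite (fluid_energyE afs).
  exact: integrable_box_int3 afs continuous_dot_sqr (@dot_sqr_le R).
have [iP0 P0] := div_cross_box box_ab sBh sE0.
have [iP1 P1] := div_cross_box box_ab sBh sE1.
(* Adding the two pointwise balances cancels the work of the current; only divergences are left,
   with integral 0. *)
have -> : fluid_energy f1 = fun x => (fluid_energy fs x + (W0 x + (- 1) * W1 x)) +
    dt * (div_cross Bh E0 x + div_cross Bh E1 x).
  apply/funext => x.
  have := lorentz_energyE x; have := field_energyE (B0m x) (Bp1 x).
  rewrite -/(W0 x) -/(W1 x) (div_crossE x sBh sE0) (div_crossE x sBh sE1) !dotDr.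
  move=> HW HG; rewrite -[LHS](subrK (fluid_energy fs x)) HG.
  by rewrite -[W1 x](subrK (W0 x)) HW; ring.
rewrite int3_boxD; first last.
- by apply: box_integrableZ; exact: box_integrableD.
- by apply: box_integrableD => //; apply: box_integrableD => //; exact: box_integrableZ.
rewrite int3_boxZ; last exact: box_integrableD.
rewrite (int3_boxD iP0 iP1) P0 P1 int3_boxD//; last first.
  by apply: box_integrableD => //; exact: box_integrableZ.
rewrite int3_boxD//; last exact: box_integrableZ.
by rewrite int3_boxZ// int3_transport_energy; ring.
Qed.

End Step.

Theorem theorem4p2 (R : realType) (M : nat) (dt : R) (a b : 'rV[R]_3)
    (f fs : nat -> 'rV[R]_3 -> 'rV[R]_3 -> R)
    (E B Bh : nat -> 'rV[R]_3 -> 'rV[R]_3)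
    (dt_gt0 : 0 < dt)
    (box_ab : forall i, a ord0 i < b ord0 i)
    (run : schemeII M dt a b f fs E B Bh) :
  forall n : nat,
    total_energy a b (f n) (E n) (Bh n) (Bh n.+1)
    = total_energy a b (f n.+1) (E n.+1) (Bh n.+1) (Bh n.+2).
Proof.
move=> n; have [af afs sE sB sBh init step] := run.
apply: (step_total_energy dt_gt0 box_ab (af n) (afs n) (af n.+1) (sE n)
  (sE n.+1) (sBh n.+1) (step n) (sBh n) (sBh n.+2)).
(* [Bh n] stands for B^(n-1/2): the relation behind level [n] is [init] when [n] is 0, and otherwise
   the second half step of the preceding step. *)
- by case: n => // n x; exact: step_faraday (step n) x.
(* The field [Bh n.+2] in the new energy comes from the first half step of the following step. *)
- by move=> x; exact: step_faraday_half (step n.+1) x.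
Qed.
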